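(* Let $k\ge 2$ be an integer and let $\ell^1=\ell^1(\mathbb{N})$ be the complex Banach algebra of absolutely summable sequences equipped with the pointwise product. Then the bidual $(\ell^1)^{**}$, equipped with the first Arens product $\Box$, has the $k$-OA property.
   Context: For a complex Banach algebra $\mathcal{B}$, a $k$-homogeneous polynomial on $\mathcal{B}$ is a map $P:\mathcal{B}\to\mathbb{C}$ for which there is a bounded symmetric $k$-linear form $\Phi:\mathcal{B}^k\to\mathbb{C}$ with $P(x)=\Phi(x,\ldots,x)$ for all $x\in\mathcal{B}$. $P$ is orthogonally additive if $P(x+y)=P(x)+P(y)$ whenever $x,y\in\mathcal{B}$ satisfy $xy=0=yx$. $P$ is standard if there is $\gamma\in\mathcal{B}^*$ with $P(x)=\langle\gamma,x^k\rangle$ for all $x\in\mathcal{B}$. $\mathcal{B}$ has the $k$-OA property ($k$-orthogonally additive property) if every orthogonally additive $k$-homogeneous polynomial on $\mathcal{B}$ is standard. For a Banach algebra $\mathcal{A}$, the first Arens product $\Box$ on $\mathcal{A}^{**}$ is given by $m\Box n=\mathrm{w}^*\text{-}\lim_\alpha \mathrm{w}^*\text{-}\lim_\beta a_\alpha b_\beta$ for nets $(a_\alpha),(b_\beta)$ in $\mathcal{A}$ weak$^*$-converging to $m,n\in\mathcal{A}^{**}$ respectively (with $\mathcal{A}$ canonically embedded in $\mathcal{A}^{**}$). *)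

(* Defs.v *)
From HB Require Import structures.
From mathcomp Require Import all_boot all_order all_algebra all_fingroup.
From mathcomp Require Import complex.
From mathcomp Require Import all_classical all_reals all_analysis.
From mathcomp Require Import lra.

Set Implicit Arguments.
Unset Strict Implicit.
Unset Printing Implicit Defensive.

Import Order.TTheory GRing.Theory Num.Theory.
Import numFieldNormedType.Exports.

Local Open Scope classical_set_scope.
Local Open Scope complex_scope.
Local Open Scope ring_scope.

Local Notation Re := complex.Re.
Local Notation Im := complex.Im.

(* A Banach algebra over K, not assumed to be unital. *)
HB.mixin Record CompleteNormedModule_isBanachAlgebra (K : numFieldType) A
    & CompleteNormedModule K A := {
  bmul : A -> A -> A;
  bmulA : associative bmul;
  bmulDl : left_distributive bmul +%R;
  bmulDr : right_distributive bmul +%R;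
  bscaleAl : forall (c : K) (x y : A), c *: bmul x y = bmul (c *: x) y;
  bscaleAr : forall (c : K) (x y : A), c *: bmul x y = bmul x (c *: y);
  ler_norm_bmul : forall x y : A, `|bmul x y| <= `|x| * `|y|
}.

#[short(type="banachAlgType")]
HB.structure Definition BanachAlgebra (K : numFieldType) :=
  {A of CompleteNormedModule K A & CompleteNormedModule_isBanachAlgebra K A}.

(* The norm of a module over R[i] takes its values in R[i]; rnorm is the same
   norm with values in R. *)
Section rnorm.
Context {R : realType} {V : normedModType R[i]}.
Implicit Types x y : V.

Definition rnorm x : R := Re `|x|.

Lemma rnormE x : (rnorm x)%:C = `|x|.
Proof. by rewrite /rnorm RRe_real // normr_real. Qed.

Lemma rnorm_ge0 x : 0 <= rnorm x.
Proof. by rewrite -ler0c rnormE. Qed.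

Lemma ler_rnorm x y : (rnorm x <= rnorm y) = (`|x| <= `|y|).
Proof. by rewrite -lecR !rnormE. Qed.

Lemma rnormD x y : rnorm (x + y) <= rnorm x + rnorm y.
Proof. by rewrite -lecR rmorphD /= !rnormE ler_normD. Qed.

Lemma rnormN x : rnorm (- x) = rnorm x.
Proof. by rewrite /rnorm normrN. Qed.

Lemma rdistC x y : rnorm (x - y) = rnorm (y - x).
Proof. by rewrite /rnorm distrC. Qed.

Lemma rdistD x y z : rnorm (x - z) <= rnorm (x - y) + rnorm (y - z).
Proof. by rewrite -[in leLHS](subrK y x) -addrA rnormD. Qed.

Lemma rnorm0 : rnorm (0 : V) = 0.
Proof. by rewrite /rnorm normr0. Qed.

Lemma rnorm0_eq0 x : rnorm x = 0 -> x = 0.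
Proof. by move=> x0; apply: normr0_eq0; rewrite -rnormE x0. Qed.

End rnorm.

Lemma rnormZ (R : realType) (V : normedModType R[i]) (c : R[i]^o) (x : V) :
  rnorm (c *: x) = rnorm c * rnorm x.
Proof.
by apply: complexI; rewrite rmorphM /= !rnormE normrZ.
Qed.

Lemma rnormM (R : realType) (a b : R[i]) :
  rnorm (a * b : R[i]^o) = rnorm (a : R[i]^o) * rnorm (b : R[i]^o).
Proof. exact: (rnormZ (a : R[i]^o) (b : R[i]^o)). Qed.

Lemma rnormC (R : realType) (r : R) : 0 <= r -> rnorm (r%:C : R[i]^o) = r.
Proof. by move=> r0; apply: complexI; rewrite rnormE ger0_norm ?ler0c. Qed.

Lemma rcvgP (R : realType) (V : normedModType R[i]) (T : Type)
    (F : set_system T) (FF : Filter F) (f : T -> V) (l : V) :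
  f @ F --> l <->
  forall e : R, 0 < e -> \forall t \near F, rnorm (l - f t) <= e.
Proof.
split=> [/cvgrPdist_le fl e e0|fl].
  have /fl : 0 < e%:C by rewrite ltcR.
  by apply: filterS => t; rewrite -rnormE lecR.
apply/cvgrPdist_le => e; rewrite ltcE => /andP[/eqP/= Ie e0].
apply: filterS (fl _ e0) => t; rewrite -lecR rnormE.
by rewrite (_ : (Re e)%:C = e) //; case: e Ie {e0 fl} => a b /= ->.
Qed.

Lemma rcauchyP (R : realType) (V : normedModType R[i])
    (F : set_system V) (FF : ProperFilter F) :
  cauchy F <->
  forall e : R, 0 < e -> exists x : V, \forall y \near F, rnorm (x - y) <= e.
Proof.
split=> [/cauchyP Fc e e0|Fc].
  have /Fc[x Fx] : 0 < e%:C by rewrite ltcR.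
  exists x; apply: filterS Fx => y.
  by rewrite -ball_normE /= -rnormE ltcR => /ltW.
apply/cauchyP => e; rewrite ltcE => /andP[/eqP/= Ie e0].
have [|x Fx] := Fc (Re e / 2); first by rewrite divr_gt0.
exists x; apply: filterS Fx => y; rewrite -ball_normE /= => xy.
have -> : e = (Re e)%:C by case: e Ie {e0 xy} => a b /= ->.
by rewrite -rnormE ltcR (le_lt_trans xy)// ltr_pdivrMr// ltr_pMr// ltr1n.
Qed.

Lemma cvg_rdist (R : realType) (V : normedModType R[i]) (T : Type)
    (F : set_system T) (FF : Filter F) (f : T -> V) (l c : V) :
  f @ F --> l -> rnorm (c - f t) @[t --> F] --> rnorm (c - l).
Proof.
move=> /rcvgP fl; apply/cvgrPdist_le => e /fl; apply: filterS => t /(le_trans _).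
apply; rewrite ler_norml.
have := rdistD c l (f t); have := rdistD c (f t) l; rewrite (rdistC (f t) l).
lra.
Qed.

Lemma complex_cauchy_cvg (R : realType) (F : set_system R[i]^o) :
  ProperFilter F -> cauchy F -> cvg F.
Proof.
move=> FF /rcauchyP Fc.
have ReB (z : R[i]) : `|Re z| <= rnorm (z : R[i]^o).
  by rewrite -lecR rnormE normc_ge_Re.
have ImB (z : R[i]) : `|Im z| <= rnorm (z : R[i]^o).
  have := ReB (z * 'i); rewrite ReiNIm normrN rnormM => /le_trans; apply.
  by rewrite -[leRHS]mulr1 ler_wpM2l ?rnorm_ge0// /rnorm normc_def/=
    expr0n/= expr1n add0r sqrtr1.
have cvg_part (p : {additive R[i] -> R}) :
    (forall z : R[i], `|p z| <= rnorm (z : R[i]^o)) ->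
    cvg ((p : R[i]^o -> R) @ F).
  move=> pB; apply: cauchy_cvg; apply/cauchyP => e e0.
  have [|x Fx] := Fc (e / 2); first by rewrite divr_gt0.
  exists (p x); apply: filterS Fx => y xy; rewrite /ball/= -raddfB.
  by rewrite (le_lt_trans (pB _))// (le_lt_trans xy)// ltr_pdivrMr// ltr_pMr// ltr1n.
have /cvg_ex[a Fa] := cvg_part (@Re R) ReB.
have /cvg_ex[b Fb] := cvg_part (@Im R) ImB.
apply/cvg_ex; exists (a +i* b : R[i]^o).
apply/rcvgP => e e0.
have e20 : 0 < e / 2 by rewrite divr_gt0.
move/cvgrPdist_le: Fa => /(_ _ e20) Fa; move/cvgrPdist_le: Fb => /(_ _ e20) Fb.
apply: filterS2 Fa Fb => -[u v]/= au bv.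
have -> : (a +i* b : R[i]^o) - (u +i* v) = ((a - u)%:C : R[i]^o) + ((b - v)%:C * 'i : R[i]^o).
  by apply/eqP; rewrite eq_complex/= !mulr0 !mul0r !mulr1 subr0 !addr0 !add0r !eqxx.
have rr (r : R) : rnorm (r%:C : R[i]^o) = `|r|.
  by rewrite /rnorm normc_def/= expr0n/= addr0 sqrtr_sqr.
rewrite (le_trans (rnormD _ _))// rnormM !rr.
rewrite [X in _ + _ * X](_ : _ = 1) ?mulr1; last first.
  by rewrite /rnorm normc_def/= expr0n/= expr1n add0r sqrtr1.
by rewrite [leRHS](splitr e) lerD.
Qed.

Lemma eval_cauchy_cvg (R : realType) (V : normedModType R[i]) (T : Type)
    (ev : V -> T -> R[i]^o) :
  injective ev ->
  (forall t, exists M : R,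
    0 < M /\ forall x y, rnorm (ev x t - ev y t) <= M * rnorm (x - y)) ->
  (forall (F : set_system V) (w : T -> R[i]^o) x (e : R), ProperFilter F ->
    (forall t, ev y t @[y --> F] --> w t) ->
    (\forall y \near F, rnorm (x - y) <= e) ->
    exists2 v, ev v = w & rnorm (x - v) <= e) ->
  forall F : set_system V, ProperFilter F -> cauchy F -> cvg F.
Proof.
move=> ev_inj evM ev_closed F FF /rcauchyP Fc.
have /choice[w Fw] : forall t, exists l, ev y t @[y --> F] --> (l : R[i]^o).
  move=> t; apply/cvg_ex; apply: complex_cauchy_cvg; apply/rcauchyP => e e0.
  have [M [M0 evMt]] := evM t.
  have [|x Fx] := Fc (e / M); first by rewrite divr_gt0.
  exists (ev x t); apply: filterS Fx => y xy /=; rewrite (le_trans (evMt _ _))//.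
  by rewrite mulrC -ler_pdivlMr.
have [x1 Fx1] := Fc _ ltr01.
have [v evv _] := ev_closed F w x1 1 FF Fw Fx1.
apply/cvg_ex; exists v; apply/rcvgP => e e0.
have [|x Fx] := Fc (e / 2); first by rewrite divr_gt0.
have [v' evv' xv'] := ev_closed F w x (e / 2) FF Fw Fx.
have vv' : v' = v by apply: ev_inj; rewrite evv' evv.
move: xv'; rewrite vv' => xv.
apply: filterS Fx => y xy; rewrite [leRHS]splitr.
by rewrite (le_trans (rdistD _ x _))// lerD// rdistC.
Qed.

Section dual.
Context {R : realType} {A : normedModType R[i]}.

Definition bounded_functional : pred (A -> R[i]^o) := fun f =>
  `[< linear f /\ exists M : R[i], forall x, `|f x| <= M * `|x| >].

Record dual := Dual {
  dual_fun :> A -> R[i]^o ;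
  _ : bounded_functional dual_fun }.

HB.instance Definition _ := [isSub for dual_fun].
HB.instance Definition _ := [Choice of dual by <:].

Lemma bounded_functional_submod_closed : submod_closed bounded_functional.
Proof.
split.
  apply/asboolP; split=> [c x y|]; first by rewrite /= scaler0 addr0.
  by exists 0 => x; rewrite normr0 mul0r.
move=> c f g /asboolP[fl [M fM]] /asboolP[gl [N gN]].
apply/asboolP; split=> [a x y|].
  rewrite !fctE fl gl !scalerDr !scalerA (mulrC c).
  by rewrite addrACA.
exists (`|c| * M + N) => x; rewrite !fctE (le_trans (ler_normD _ _))//.
by rewrite mulrDl lerD// normrZ -mulrA ler_wpM2l.
Qed.

HB.instance Definition _ :=
  GRing.isSubmodClosed.Build R[i] (A -> R[i]^o) bounded_functional
    (GRing.submod_closed_semi bounded_functional_submod_closed).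
HB.instance Definition _ := [SubChoice_isSubLmodule of dual by <:].

Implicit Types f g : dual.

Lemma dual_linear f : linear f.
Proof. by have /asboolP[] := valP f. Qed.

Lemma dual_bounded f : exists M : R[i], forall x, `|f x| <= M * `|x|.
Proof. by have /asboolP[] := valP f. Qed.

HB.instance Definition _ f :=
  GRing.isLinear.Build R[i] A R[i]^o _ (dual_fun f) (dual_linear f).

Lemma dualP f g : f =1 g -> f = g.
Proof. by move=> fg; apply: val_inj; apply/funext. Qed.

Lemma dualDE f g x : (f + g) x = f x + g x. Proof. by []. Qed.

Lemma dualZE (c : R[i]) f x : (c *: f) x = c * f x. Proof. by []. Qed.

Lemma dualNE f x : (- f) x = - f x. Proof. by []. Qed.

Definition dual_norm f : R := sup [set rnorm (f x) | x in [set x | `|x| <= 1]].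

Let dual_has_sup f : has_sup [set rnorm (f x) | x in [set x | `|x| <= 1]].
Proof.
split; first by exists (rnorm (f 0)), 0 => //=; rewrite normr0.
have [M fM] := dual_bounded f; exists (rnorm (M : R[i]^o)) => _ [x /= x1 <-].
rewrite -lecR !rnormE.
have : `|f x| <= `|M : R[i]^o| * `|x|.
  rewrite -[`|x|]normr_id -(normrM (M : R[i])) ger0_norm//.
  exact: le_trans (fM x).
by move=> /le_trans; apply; rewrite ler_piMr.
Qed.

Lemma dual_norm_ge0 f : 0 <= dual_norm f.
Proof.
apply: le_trans (sup_upper_bound (dual_has_sup f) _); last first.
  by exists 0 => //=; rewrite normr0.
exact: rnorm_ge0.
Qed.

Lemma dual_norm_ub f x : rnorm (f x) <= dual_norm f * rnorm x.
Proof.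
have [->|x0] := eqVneq x 0; first by rewrite linear0 !rnorm0 mulr0.
have rx0 : 0 < rnorm x by rewrite lt_def rnorm_ge0 andbT; apply: contra_neq x0 => /rnorm0_eq0.
rewrite -ler_pdivrMr//.
apply: (sup_upper_bound (dual_has_sup f)); exists ((rnorm x)^-1%:C *: x) => /=.
  by rewrite normrZ -(rnormE x) ger0_norm ?ler0c ?invr_ge0 ?rnorm_ge0// -rmorphM/= mulVf ?gt_eqF.
by rewrite linearZ/= rnormM rnormC ?invr_ge0 ?rnorm_ge0// mulrC.
Qed.

Lemma dual_norm_le f (M : R) : 0 <= M ->
  (forall x, rnorm (f x) <= M * rnorm x) -> dual_norm f <= M.
Proof.
move=> M0 fM; apply: ge_sup => [|_ [x /= x1 <-]]; first by have [] := dual_has_sup f.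
rewrite (le_trans (fM x))// ler_piMr//.
by rewrite -lecR rnormE.
Qed.

Let dual_normD f g : (dual_norm (f + g))%:C <= (dual_norm f)%:C + (dual_norm g)%:C.
Proof.
rewrite -rmorphD /= lecR dual_norm_le ?addr_ge0 ?dual_norm_ge0// => x.
by rewrite dualDE mulrDl (le_trans (rnormD _ _))// lerD ?dual_norm_ub.
Qed.

Let dual_normZ_le (c : R[i]) f : dual_norm (c *: f) <= rnorm (c : R[i]^o) * dual_norm f.
Proof.
apply: dual_norm_le => [|x]; first by rewrite mulr_ge0 ?rnorm_ge0 ?dual_norm_ge0.
by rewrite dualZE rnormM -mulrA ler_wpM2l ?rnorm_ge0 ?dual_norm_ub.
Qed.

Let dual_normZ (c : R[i]) f : (dual_norm (c *: f))%:C = `|c| * (dual_norm f)%:C.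
Proof.
rewrite -(rnormE (c : R[i]^o)) -rmorphM /=; congr (_%:C).
apply/eqP; rewrite eq_le dual_normZ_le /=.
have [->|c0] := eqVneq c 0; first by rewrite rnorm0 mul0r dual_norm_ge0.
have := dual_normZ_le c^-1 (c *: f); rewrite scalerA mulVf// scale1r.
have cV : rnorm (c : R[i]^o) * rnorm (c^-1 : R[i]^o) = 1.
  by rewrite -rnormM mulfV// /rnorm normr1.
move=> /(ler_wpM2l (rnorm_ge0 (c : R[i]^o))) /le_trans; apply.
by rewrite mulrA cV mul1r.
Qed.

Let dual_norm0_eq0 f : (dual_norm f)%:C = 0 -> f = 0.
Proof.
move=> /complexI f0; apply: dualP => x.
apply: rnorm0_eq0; apply/eqP; rewrite eq_le rnorm_ge0 andbT.
by rewrite (le_trans (dual_norm_ub _ _))// f0 mul0r.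
Qed.

HB.instance Definition _ :=
  Lmodule_isNormed.Build R[i] dual dual_normD dual_normZ dual_norm0_eq0.

Lemma dual_normE f : `|f| = (dual_norm f)%:C. Proof. by []. Qed.

Lemma dual_rnormE f : rnorm f = dual_norm f. Proof. by []. Qed.

Lemma ler_dual_norm f x : `|f x| <= `|f| * `|x|.
Proof.
by rewrite dual_normE -(rnormE x) -(rnormE (f x)) -rmorphM/= lecR dual_norm_ub.
Qed.

Let dual_cauchy_cvg (F : set_system dual) : ProperFilter F -> cauchy F -> cvg F.
Proof.
apply: (@eval_cauchy_cvg R dual A dual_fun).
- by move=> f g fg; apply: val_inj.
- move=> x; exists (rnorm x + 1); split; first by rewrite ltr_wpDl ?rnorm_ge0.
  move=> f g; rewrite (le_trans (dual_norm_ub (f - g) x))// mulrC.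
  by rewrite ler_wpM2r ?dual_norm_ge0// lerDl.
move=> {}F w f e FF Fw Fe.
have wlin : linear w.
  move=> c x y.
  apply: (cvg_unique _ (Fw (c *: x + y))); first exact: norm_hausdorff.
  rewrite (_ : (fun g : dual => g (c *: x + y)) = (fun g : dual => c *: g x + g y)).
    by apply: cvgD => //; apply: cvgZr.
  by apply/funext => g; rewrite linearP.
have wdist x : rnorm (f x - w x) <= e * rnorm x.
  rewrite -(cvg_lim (@Rhausdorff R) (cvg_rdist _ (c := f x) (Fw x)))//.
  apply: limr_le; first by apply/cvg_ex; eexists; exact: cvg_rdist (Fw x).
  apply: filterS Fe => g fg; rewrite (le_trans (dual_norm_ub (f - g) x))//.
  by rewrite ler_wpM2r ?rnorm_ge0.
have e0 : 0 <= e by have [g fg] := filter_ex Fe; apply: le_trans fg; exact: rnorm_ge0.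
have wbnd : bounded_functional w.
  apply/asboolP; split=> //; exists (dual_norm f + e)%:C => x.
  rewrite -(rnormE x) -(rnormE (w x)) -rmorphM/= lecR.
  rewrite -[w x]opprK rnormN -[X in rnorm X]addr0 -[0](subrr (f x)).
  rewrite (_ : - w x + _ = (f x - w x) - f x); last by rewrite addrA (addrC (- w x)).
  by rewrite (le_trans (rnormD _ _))// rnormN mulrDl addrC lerD// dual_norm_ub.
exists (Dual wbnd) => //.
by rewrite dual_rnormE dual_norm_le.
Qed.

HB.instance Definition _ := Uniform_isComplete.Build dual dual_cauchy_cvg.

End dual.
Arguments dual {R} A.
Arguments Dual {R A} dual_fun _.

Section homogeneous_polynomial.
Context {R : realType} {B : banachAlgType R[i]}.

Definition multilinear_form k (Phi : ('I_k -> B) -> R[i]^o) :=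
  forall (x : 'I_k -> B) (i : 'I_k),
    linear (fun y : B => Phi (@dfwith 'I_k (fun=> B) x i y)).

Definition symmetric_form k (Phi : ('I_k -> B) -> R[i]^o) :=
  forall (s : 'S_k) (x : 'I_k -> B), Phi (x \o s) = Phi x.

Definition bounded_form k (Phi : ('I_k -> B) -> R[i]^o) :=
  exists M : R[i], forall x : 'I_k -> B, `|Phi x| <= M * \prod_(i < k) `|x i|.

Definition homogeneous_polynomial k (P : B -> R[i]^o) :=
  exists Phi : ('I_k -> B) -> R[i]^o,
    [/\ multilinear_form Phi, symmetric_form Phi, bounded_form Phi
      & forall x, P x = Phi (fun=> x)].

Definition orthogonally_additive (P : B -> R[i]^o) :=
  forall x y : B, bmul x y = 0 -> bmul y x = 0 -> P (x + y) = P x + P y.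

(* x ^ k for k > 0; as B need not have a unit, bpow x 0 is the junk value 0 *)
Definition bpow (x : B) k : B := iterop k bmul x 0.

Definition standard_polynomial k (P : B -> R[i]^o) :=
  exists gamma : dual B, forall x, P x = gamma (bpow x k).

End homogeneous_polynomial.

Definition OA_property (R : realType) (B : banachAlgType R[i]) (k : nat) :=
  forall P : B -> R[i]^o,
    homogeneous_polynomial k P -> orthogonally_additive P ->
    standard_polynomial k P.

Definition bidual (R : realType) (A : normedModType R[i]) : Type :=
  dual (dual A).
HB.instance Definition _ (R : realType) (A : normedModType R[i]) :=
  CompleteNormedModule.on (bidual A).

(* weak-* convergence of the family u to p along the filter F *)
Definition wstar_cvg (R : realType) (E : normedModType R[i]) (I : Type)
    (F : set_system I) (u : I -> dual E) (p : dual E) :=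
  forall x : E, u i x @[i --> F] --> p x.

Lemma bounded_functionalP (R : realType) (E : normedModType R[i])
    (f : E -> R[i]^o) (M : R) :
  linear f -> (forall x, rnorm (f x) <= M * rnorm x) -> bounded_functional f.
Proof.
move=> fl fM; apply/asboolP; split=> //; exists M%:C => x.
by rewrite -(rnormE x) -(rnormE (f x)) -rmorphM/= lecR.
Qed.

Section canonical_embedding.
Context {R : realType} {A : normedModType R[i]}.

Let evalb a : bounded_functional (fun f : dual A => f a).
Proof.
apply: (@bounded_functionalP _ _ _ (rnorm a)) => // f.
by rewrite mulrC dual_norm_ub.
Qed.

Definition canon (a : A) : bidual A := Dual (fun f : dual A => f a) (evalb a).

Lemma canonE a (f : dual A) : canon a f = f a. Proof. by []. Qed.

(* Every m is the weak-* limit of a net in A: on finitely many functionals it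
   even coincides with an element of A. *)
Lemma dual_seq_interp (s : seq (dual A)) (m : bidual A) :
  exists a, forall f, f \in s -> f a = m f.
Proof.
have span : forall (s : seq (dual A)) (f : dual A),
    (forall z, (forall g, g \in s -> g z = 0) -> f z = 0) ->
    forall a, (forall g, g \in s -> g a = m g) -> f a = m f.
  elim=> [|g t IH] f fK a am.
    have -> : f = 0 by apply: dualP => z; exact: fK.
    by rewrite linear0.
  have [gK|] := pselect (forall z, (forall h, h \in t -> h z = 0) -> g z = 0).
    apply: IH => [z zK|h ht]; last by apply: am; rewrite inE ht orbT.
    by apply: fK => h; rewrite inE => /predU1P[->|/zK//]; exact: gK.
  move=> /existsNP[z0 /not_implyP[z0K /eqP gz0]].
  pose c : R[i] := f z0 / g z0.
  have hc : (f - c *: g) a = m (f - c *: g).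
    apply: IH => [z zK|h ht]; last by apply: am; rewrite inE ht orbT.
    have : f (z - (g z / g z0) *: z0) = 0.
      apply: fK => h; rewrite inE => /predU1P[->|ht].
        by rewrite linearB linearZ/= /GRing.scale/= mulfVK ?subrr.
      by rewrite linearB linearZ/= (zK _ ht) (z0K _ ht) scaler0 subrr.
    rewrite linearB linearZ => fz.
    rewrite dualDE dualNE dualZE -fz /c /GRing.scale/=; congr (_ - _).
    by rewrite mulrAC (mulrC (f z0)) mulrAC.
  have ha : (f - c *: g) a = f a - c * g a by [].
  have hm : m (f - c *: g) = m f - c * m g by rewrite linearB linearZ.
  by move: hc; rewrite ha hm -(am g) ?mem_head// => /addIr.
elim: s => [|f t [a am]]; first by exists 0.
have [fK|] := pselect (forall z, (forall g, g \in t -> g z = 0) -> f z = 0).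
  exists a => g; rewrite inE => /predU1P[->|/am//]; exact: (span t).
move=> /existsNP[z /not_implyP[zK /eqP fz]].
exists (a + ((m f - f a) / f z) *: z) => g.
rewrite inE linearD linearZ/= => /predU1P[->|gt].
  by rewrite /GRing.scale/= mulfVK// addrC subrK.
by rewrite (zK _ gt) scaler0 addr0 am.
Qed.

Definition interp_filter (m : bidual A) : set_system A :=
  [set P | exists s : seq (dual A),
    [set a | forall f, f \in s -> f a = m f] `<=` P].

Lemma interp_filter_proper m : ProperFilter (interp_filter m).
Proof.
split.
  by move=> [s sP]; have [a /sP] := dual_seq_interp s m.
split; first by exists [::].
- move=> P Q [s sP] [t tQ]; exists (s ++ t) => a am; split.
    by apply: sP => f fs; apply: am; rewrite mem_cat fs.
  by apply: tQ => f fs; apply: am; rewrite mem_cat fs orbT.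
- by move=> P Q PQ [s sP]; exists s => a /sP/PQ.
Qed.

Lemma interp_filter_cvg m : wstar_cvg (interp_filter m) canon m.
Proof.
move=> f; have FF := interp_filter_proper m.
apply/rcvgP => e e0; exists [:: f] => a /= am.
by rewrite am ?mem_head// subrr rnorm0 ltW.
Qed.

End canonical_embedding.

Section arens.
Context {R : realType} {A : banachAlgType R[i]}.
Implicit Types m n p : bidual A.

(* p = w*-lim_i w*-lim_j a_i b_j for all nets (a_i), (b_j) in A that converge
   weak-* to m and n. A net is a family of elements of A whose index set
   carries a proper filter; for a directed index set, take its tails. Existence
   and uniqueness of p are arens3P and iterated_wstar_lim_unique. *)
Definition iterated_wstar_lim m n p :=
  forall (I J : Type) (F : set_system I) (G : set_system J)
    (a : I -> A) (b : J -> A), ProperFilter F -> ProperFilter G ->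
    wstar_cvg F (canon \o a) m -> wstar_cvg G (canon \o b) n ->
    exists2 l : I -> bidual A,
      forall i, wstar_cvg G (fun j => canon (bmul (a i) (b j))) (l i)
      & wstar_cvg F l p.

Definition arens m n : bidual A := get (iterated_wstar_lim m n).

Lemma rnorm_bmul (x y : A) : rnorm (bmul x y) <= rnorm x * rnorm y.
Proof. by rewrite -lecR rmorphM/= !rnormE ler_norm_bmul. Qed.

(* f.a = f(a _) in A*, n.f = n(f._) in A*; arensE below identifies the first
   Arens product of m and n with the functional f |-> m (n.f) *)
Let act1b (f : dual A) (a : A) : bounded_functional (fun b => f (bmul a b)).
Proof.
apply: (@bounded_functionalP _ _ _ (dual_norm f * rnorm a)).
  by move=> c x y; rewrite bmulDr -bscaleAr linearP.
move=> x /=; rewrite (le_trans (dual_norm_ub _ _))// -mulrA.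
by rewrite ler_wpM2l ?dual_norm_ge0 ?rnorm_bmul.
Qed.

Definition dual_act (f : dual A) (a : A) : dual A := Dual _ (act1b f a).

Let dual_act_norm f a : dual_norm (dual_act f a) <= dual_norm f * rnorm a.
Proof.
apply: dual_norm_le => [|x]; first by rewrite mulr_ge0 ?dual_norm_ge0 ?rnorm_ge0.
rewrite /= (le_trans (dual_norm_ub _ _))// -mulrA.
by rewrite ler_wpM2l ?dual_norm_ge0 ?rnorm_bmul.
Qed.

Let act2b n (f : dual A) : bounded_functional (fun a => n (dual_act f a)).
Proof.
apply: (@bounded_functionalP _ _ _ (dual_norm n * dual_norm f)).
  move=> c x y.
  have -> : dual_act f (c *: x + y) = c *: dual_act f x + dual_act f y.
    by apply: dualP => z /=; rewrite bmulDl -bscaleAl linearP.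
  exact: linearP.
move=> x /=; rewrite (le_trans (dual_norm_ub _ _))// -mulrA.
by rewrite ler_wpM2l ?dual_norm_ge0 ?dual_act_norm.
Qed.

Definition bidual_act n (f : dual A) : dual A := Dual _ (act2b n f).

Let bidual_act_norm n f : dual_norm (bidual_act n f) <= dual_norm n * dual_norm f.
Proof.
apply: dual_norm_le => [|x]; first by rewrite mulr_ge0 ?dual_norm_ge0.
rewrite /= (le_trans (dual_norm_ub _ _))// -mulrA.
by rewrite ler_wpM2l ?dual_norm_ge0 ?dual_act_norm.
Qed.

Let act3b m n : bounded_functional (fun f : dual A => m (bidual_act n f)).
Proof.
apply: (@bounded_functionalP _ _ _ (dual_norm m * dual_norm n)).
  move=> c f g.
  have -> : bidual_act n (c *: f + g) = c *: bidual_act n f + bidual_act n g.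
    apply: dualP => a.
    have actE : dual_act (c *: f + g) a = c *: dual_act f a + dual_act g a.
      by apply: dualP.
    by rewrite /= actE linearP.
  exact: linearP.
move=> x /=; rewrite (le_trans (dual_norm_ub _ _))// -mulrA.
by rewrite ler_wpM2l ?dual_norm_ge0 ?bidual_act_norm.
Qed.

Definition arens3 m n : bidual A := Dual _ (act3b m n).

Lemma arens3P m n : iterated_wstar_lim m n (arens3 m n).
Proof.
move=> I J F G a b FF GG am bn.
exists (fun i => arens3 (canon (a i)) n) => [i f|f].
  exact: (bn (dual_act f (a i))).
exact: (am (bidual_act n f)).
Qed.

Lemma iterated_wstar_lim_unique m n p q :
  iterated_wstar_lim m n p -> iterated_wstar_lim m n q -> p = q.
Proof.
move=> /(_ _ _ _ _ id id (interp_filter_proper m) (interp_filter_proper n)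
  (@interp_filter_cvg _ _ m) (@interp_filter_cvg _ _ n))[l1 l1P l1p].
move=> /(_ _ _ _ _ id id (interp_filter_proper m) (interp_filter_proper n)
  (@interp_filter_cvg _ _ m) (@interp_filter_cvg _ _ n))[l2 l2P l2q].
have FF := interp_filter_proper m; have GG := interp_filter_proper n.
have l12 : l1 = l2.
  apply/funext => i; apply: dualP => f.
  exact: (cvg_unique (@norm_hausdorff _ _) (l1P i f) (l2P i f)).
apply: dualP => f; move: (l1p f); rewrite l12 => l2p.
exact: (cvg_unique (@norm_hausdorff _ _) l2p (l2q f)).
Qed.

Lemma arensP m n : iterated_wstar_lim m n (arens m n).
Proof. by apply: getPex; exists (arens3 m n); exact: arens3P. Qed.

Lemma arensE m n : arens m n = arens3 m n.
Proof. exact: (iterated_wstar_lim_unique (@arensP m n) (@arens3P m n)). Qed.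

Let arensA : associative arens.
Proof.
move=> m n p; rewrite !arensE; apply: dualP => f /=.
have -> // : bidual_act (arens3 n p) f = bidual_act n (bidual_act p f).
apply: dualP => a /=.
have -> // : dual_act (bidual_act p f) a = bidual_act p (dual_act f a).
apply: dualP => b /=.
have -> // : dual_act (dual_act f a) b = dual_act f (bmul a b).
by apply: dualP => c /=; rewrite bmulA.
Qed.

Let arensDl : left_distributive arens +%R.
Proof. by move=> m n p; rewrite !arensE; apply: dualP. Qed.

Let arensDr : right_distributive arens +%R.
Proof.
move=> m n p; rewrite !arensE; apply: dualP => f /=.
have -> : bidual_act (n + p) f = bidual_act n f + bidual_act p f by apply: dualP.
exact: linearD.
Qed.

Let arensAl (c : R[i]) m n : c *: arens m n = arens (c *: m) n.
Proof. by rewrite !arensE; apply: dualP. Qed.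

Let arensAr (c : R[i]) m n : c *: arens m n = arens m (c *: n).
Proof.
rewrite !arensE; apply: dualP => f /=.
have -> : bidual_act (c *: n) f = c *: bidual_act n f by apply: dualP.
by apply/esym; exact: linearZ.
Qed.

Let ler_norm_arens m n : `|arens m n| <= `|m| * `|n|.
Proof.
rewrite arensE !dual_normE -rmorphM/= lecR.
apply: dual_norm_le => [|f]; first by rewrite mulr_ge0 ?dual_norm_ge0.
rewrite /= (le_trans (dual_norm_ub _ _))// -mulrA.
by rewrite ler_wpM2l ?dual_norm_ge0 ?bidual_act_norm.
Qed.

HB.instance Definition _ :=
  CompleteNormedModule_isBanachAlgebra.Build R[i] (bidual A)
    arensA arensDl arensDr arensAl arensAr ler_norm_arens.

End arens.

Section ell1.
Context {R : realType}.

Definition abs_summable : pred (nat -> R[i]^o) := fun u =>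
  `[< cvgn (series (fun n => rnorm (u n))) >].

Record ell1 := Ell1 { ell1_fun :> nat -> R[i]^o ; _ : abs_summable ell1_fun }.

HB.instance Definition _ := [isSub for ell1_fun].
HB.instance Definition _ := [Choice of ell1 by <:].

Definition ell1_norm (u : nat -> R[i]^o) : R :=
  limn (series (fun n => rnorm (u n))).

Let series_nd (u : nat -> R[i]^o) :
  nondecreasing_seq (series (fun n => rnorm (u n))).
Proof. by apply: nondecreasing_series => n _ _; exact: rnorm_ge0. Qed.

Lemma abs_summableP (u : nat -> R[i]^o) (M : R) :
  (forall N, series (fun n => rnorm (u n)) N <= M) -> abs_summable u.
Proof.
move=> uM; apply/asboolP/nondecreasing_is_cvgn => //.
by exists M => _ [N _ <-].
Qed.

Lemma ell1_norm_le (u : nat -> R[i]^o) (M : R) :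
  (forall N, series (fun n => rnorm (u n)) N <= M) -> ell1_norm u <= M.
Proof.
move=> uM; apply: limr_le; first exact: (asboolW (abs_summableP uM)).
by apply: nearW.
Qed.

Lemma ell1_norm_ub (u : ell1) N : series (fun n => rnorm (u n)) N <= ell1_norm u.
Proof. by apply: nondecreasing_cvgn_le => //; exact: (asboolW (valP u)). Qed.

Lemma ell1_norm_coord (u : ell1) n : rnorm (u n) <= ell1_norm u.
Proof.
apply: le_trans (ell1_norm_ub u n.+1); rewrite /series/= big_nat_recr//=.
by rewrite lerDr sumr_ge0// => i _; exact: rnorm_ge0.
Qed.

Lemma ell1_norm_ge0 (u : ell1) : 0 <= ell1_norm u.
Proof. exact: le_trans (rnorm_ge0 _) (ell1_norm_coord u 0). Qed.

Let series_le (u v : nat -> R[i]^o) (c d : R) (w : nat -> R[i]^o) N :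
  0 <= c -> 0 <= d ->
  (forall n, rnorm (w n) <= c * rnorm (u n) + d * rnorm (v n)) ->
  series (fun n => rnorm (w n)) N <=
  c * series (fun n => rnorm (u n)) N + d * series (fun n => rnorm (v n)) N.
Proof.
move=> c0 d0 wuv; rewrite /series/= !mulr_sumr -big_split/=.
exact: ler_sum.
Qed.

Let series_le_norm (u v : ell1) (c d : R) (w : nat -> R[i]^o) :
  0 <= c -> 0 <= d ->
  (forall n, rnorm (w n) <= c * rnorm (u n) + d * rnorm (v n)) ->
  forall N, series (fun n => rnorm (w n)) N <= c * ell1_norm u + d * ell1_norm v.
Proof.
move=> c0 d0 wuv N; apply: le_trans (series_le N c0 d0 wuv) _.
by rewrite lerD// ler_wpM2l// ell1_norm_ub.
Qed.

Lemma abs_summable_submod_closed : submod_closed abs_summable.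
Proof.
split.
  apply: (@abs_summableP _ 0) => N.
  by rewrite /series/= big1// => i _; rewrite rnorm0.
move=> c u v us vs.
apply: abs_summableP.
apply: (series_le_norm (u := Ell1 us) (v := Ell1 vs)
  (rnorm_ge0 (c : R[i]^o)) ler01) => n /=.
by rewrite !fctE mul1r (le_trans (rnormD _ _))// rnormZ.
Qed.

HB.instance Definition _ :=
  GRing.isSubmodClosed.Build R[i] (nat -> R[i]^o) abs_summable
    (GRing.submod_closed_semi abs_summable_submod_closed).
HB.instance Definition _ := [SubChoice_isSubLmodule of ell1 by <:].

Implicit Types u v : ell1.

Lemma ell1P u v : u =1 v -> u = v.
Proof. by move=> uv; apply: val_inj; apply/funext. Qed.

Let ell1_normD u v :
  (ell1_norm (u + v : ell1))%:C <= (ell1_norm u)%:C + (ell1_norm v)%:C.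
Proof.
rewrite -rmorphD /= lecR -[ell1_norm u]mul1r -[ell1_norm v]mul1r.
apply: ell1_norm_le; apply: series_le_norm => // n.
by rewrite !mul1r rnormD.
Qed.

Let ell1_normZ_le (c : R[i]) u :
  ell1_norm (c *: u : ell1) <= rnorm (c : R[i]^o) * ell1_norm u.
Proof.
rewrite -[leRHS]addr0 -[X in _ + X](mul0r (ell1_norm u)).
apply: ell1_norm_le; apply: series_le_norm => // [|n]; first exact: rnorm_ge0.
by rewrite mul0r addr0 -rnormZ.
Qed.

Let ell1_normZ (c : R[i]) u :
  (ell1_norm (c *: u : ell1))%:C = `|c| * (ell1_norm u)%:C.
Proof.
rewrite -(rnormE (c : R[i]^o)) -rmorphM /=; congr (_%:C).
apply/eqP; rewrite eq_le ell1_normZ_le /=.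
have [->|c0] := eqVneq c 0.
  by rewrite rnorm0 mul0r; exact: (ell1_norm_ge0 (0 *: u)).
have := ell1_normZ_le c^-1 (c *: u); rewrite scalerA mulVf// scale1r.
have cV : rnorm (c : R[i]^o) * rnorm (c^-1 : R[i]^o) = 1.
  by rewrite -rnormM mulfV// /rnorm normr1.
move=> /(ler_wpM2l (rnorm_ge0 (c : R[i]^o))) /le_trans; apply.
by rewrite mulrA cV mul1r.
Qed.

Let ell1_norm0_eq0 u : (ell1_norm u)%:C = 0 -> u = 0.
Proof.
move=> /complexI u0; apply: ell1P => n.
apply: rnorm0_eq0; apply/eqP; rewrite eq_le rnorm_ge0 andbT.
by rewrite (le_trans (ell1_norm_coord _ _))// u0.
Qed.

HB.instance Definition _ :=
  Lmodule_isNormed.Build R[i] ell1 ell1_normD ell1_normZ ell1_norm0_eq0.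

Lemma ell1_normE u : `|u| = (ell1_norm u)%:C. Proof. by []. Qed.

Lemma ell1_rnormE u : rnorm u = ell1_norm u. Proof. by []. Qed.

Let ell1_cauchy_cvg (F : set_system ell1) :
  ProperFilter F -> cauchy F -> cvg F.
Proof.
apply: (@eval_cauchy_cvg R ell1 nat ell1_fun).
- by move=> u v uv; apply: val_inj.
- by move=> n; exists 1; split=> // u v; rewrite mul1r (ell1_norm_coord (u - v)).
move=> {}F w u e FF Fw Fe.
have uwe N : series (fun n => rnorm (u n - w n)) N <= e.
  have cvgN : series (fun n => rnorm (u n - (v : ell1) n)) N @[v --> F] -->
              series (fun n => rnorm (u n - w n)) N.
    elim: N => [|N IH].
      rewrite /series/= big_geq//.
      rewrite (_ : (fun v : ell1 => _) = cst 0); first exact: cvg_cst.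
      by apply/funext => v; rewrite big_geq.
    rewrite seriesSr.
    rewrite (_ : (fun v : ell1 => _) = (fun v : ell1 =>
      series (fun n => rnorm (u n - v n)) N + rnorm (u N - v N))).
      by apply: cvgD IH _; exact: cvg_rdist (Fw N).
    by apply/funext => v; rewrite seriesSr.
  rewrite -(cvg_lim (@Rhausdorff R) cvgN).
  apply: limr_le; first by apply/cvg_ex; eexists; exact: cvgN.
  by apply: filterS Fe => v; apply: le_trans; exact: (ell1_norm_ub (u - v)).
have uws : abs_summable (fun n => u n - w n) by exact: abs_summableP uwe.
have ws : abs_summable w.
  apply: abs_summableP.
  apply: (series_le_norm (u := u) (v := Ell1 uws) ler01 ler01) => n /=.
  rewrite !mul1r -[X in _ + X]rnormN opprB addrC.
  by rewrite -[in leLHS](subrK (u n) (w n)) rnormD.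
exists (Ell1 ws) => //.
exact: ell1_norm_le.
Qed.

HB.instance Definition _ := Uniform_isComplete.Build ell1 ell1_cauchy_cvg.

Let mul_bound u v n : rnorm (u n * v n : R[i]^o) <=
  0 * rnorm (u n) + ell1_norm u * rnorm (v n).
Proof.
by rewrite mul0r add0r rnormM ler_wpM2r ?rnorm_ge0 ?ell1_norm_coord.
Qed.

Let mul_summable u v : abs_summable (fun n => u n * v n : R[i]^o).
Proof.
apply: abs_summableP.
by apply: series_le_norm (mul_bound u v) => //; exact: ell1_norm_ge0.
Qed.

Definition ell1_mul u v : ell1 := Ell1 (mul_summable u v).

Let ell1_mulA : associative ell1_mul.
Proof. by move=> u v w; apply: ell1P => n /=; rewrite mulrA. Qed.

Let ell1_mulDl : left_distributive ell1_mul +%R.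
Proof. by move=> u v w; apply: ell1P => n /=; rewrite mulrDl. Qed.

Let ell1_mulDr : right_distributive ell1_mul +%R.
Proof. by move=> u v w; apply: ell1P => n /=; rewrite mulrDr. Qed.

Let ell1_mulAl (c : R[i]) u v : c *: ell1_mul u v = ell1_mul (c *: u) v.
Proof. by apply: ell1P => n; exact: (mulrA c (u n) (v n)). Qed.

Let ell1_mulAr (c : R[i]) u v : c *: ell1_mul u v = ell1_mul u (c *: v).
Proof. by apply: ell1P => n; exact: (mulrCA c (u n) (v n)). Qed.

Let ler_norm_ell1_mul u v : `|ell1_mul u v| <= `|u| * `|v|.
Proof.
rewrite !ell1_normE -rmorphM/= lecR -[leRHS]add0r -(mul0r (ell1_norm u)).
apply: ell1_norm_le.
by apply: series_le_norm (mul_bound u v) => //; exact: ell1_norm_ge0.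
Qed.

HB.instance Definition _ :=
  CompleteNormedModule_isBanachAlgebra.Build R[i] ell1
    ell1_mulA ell1_mulDl ell1_mulDr ell1_mulAl ell1_mulAr ler_norm_ell1_mul.

End ell1.
Arguments ell1 R : clear implicits.

(* Main.v *)
(* Let N be the set of the m in the bidual that kill every coordinate
   functional. Each m is the sum of the image of the sequence
   (m(coord i))_i, which is in ell^1, and of an element of N. Functionals of
   the form f.a and n.f lie in c_0, the closed span of the coordinates, so N
   annihilates the whole bidual. On N an orthogonally additive P is additive,
   whence 2 P = 2 ^ k P and P = 0 there; so P m = P (m(coord i))_i. On ell^1,
   orthogonal additivity and the splitting of a sequence into finitely many
   terms and a small tail give P a = sum_i P(e_i) a_i ^ k. *)
Require Import Defs.
From mathcomp Require Import all_boot all_order all_algebra.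
From mathcomp Require Import all_classical all_reals all_analysis.
From mathcomp Require Import complex.

Set Implicit Arguments.
Unset Strict Implicit.
Unset Printing Implicit Defensive.

Import Order.TTheory GRing.Theory Num.Theory.
Import numFieldNormedType.Exports.

Local Open Scope classical_set_scope.
Local Open Scope complex_scope.
Local Open Scope ring_scope.

(** * Scaling and boundedness of homogeneous polynomials *)

Section homogeneous_polynomial.
Context {R : realType} {B : banachAlgType R[i]}.
Variables (k : nat) (P : B -> R[i]^o).
Hypothesis Pk : homogeneous_polynomial k P.

Lemma homogeneous_polynomialZ (c : R[i]) x : P (c *: x) = c ^+ k * P x.
Proof.
have [Phi [Phil _ _ PE]] := Pk; rewrite !PE.
(* Multilinearity is used one argument at a time: the first [j] arguments carry the factor [c]. *)
have H j : (j <= k)%N ->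
    Phi (fun i : 'I_k => if (i < j)%N then c *: x else x) = c ^+ j * Phi (fun=> x).
  elim: j => [|j IH] jk; first by rewrite expr0 mul1r.
  pose y (i : 'I_k) := if (i < j)%N then c *: x else x.
  have yE z : dfwith y (Ordinal jk) z =
      fun i : 'I_k => if (i == Ordinal jk) then z else y i.
    apply/funext => i; case: dfwithP => [|i' ii']; first by rewrite eqxx.
    by rewrite eq_sym (negbTE ii').
  transitivity (c * Phi y); last by rewrite IH 1?ltnW// exprS mulrA.
  have := GRing.scalable_linear (Phil y (Ordinal jk)) c x; rewrite /= !yE => Phic.
  transitivity (Phi (fun i : 'I_k => if i == Ordinal jk then c *: x else y i)).
    congr Phi; apply/funext => i; rewrite /y -val_eqE /= ltnS leq_eqVlt.
    by case: eqP.
  rewrite Phic; congr (_ * Phi _); apply/funext => i; rewrite /y -val_eqE /=.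
  by case: eqP => // ->; rewrite ltnn.
rewrite -(H k (leqnn k)); by congr Phi; apply/funext => i; rewrite ltn_ord.
Qed.

Lemma homogeneous_polynomial_bounded :
  exists2 C : R, 0 <= C & forall x, rnorm (P x) <= C * rnorm x ^+ k.
Proof.
have [Phi [_ _ [M PhiM] PE]] := Pk.
exists (rnorm (M : R[i]^o)) => [|x]; first exact: rnorm_ge0.
have := PhiM (fun=> x); rewrite prodr_const card_ord -PE => PM.
rewrite -lecR rmorphM rmorphXn /= !rnormE; apply: (le_trans PM).
(* [M] is only a complex number, but its product with the norms bounds a norm, hence is real and at
   most its own modulus. *)
apply: le_trans (real_ler_norm _) _; first exact/ger0_real/(le_trans _ PM).
by rewrite normrM normrX normr_id.
Qed.

End homogeneous_polynomial.

(** * Powers in a Banach algebra *)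

Section powers.
Context {R : realType} {B : banachAlgType R[i]}.

(** The recursion starts at exponent 2: [bpow x 0] is the default value 0, not a unit. *)
Lemma bpow_succ (x : B) j :
  bpow x j.+2 = bmul x (bpow x j.+1).
Proof. by []. Qed.

Lemma rnorm_bpow (x : B) j :
  rnorm (bpow x j.+1) <= rnorm x ^+ j.+1.
Proof.
elim: j => [|j IH]; first by rewrite expr1.
rewrite bpow_succ (le_trans (rnorm_bmul _ _))// exprS.
by rewrite ler_wpM2l ?rnorm_ge0.
Qed.

End powers.

(** * Coordinates, unit vectors and tails in ell^1 *)

Section ell1_coordinates.
Context {R : realType}.
Implicit Types (a b : ell1 R) (f g : dual (ell1 R)) (m p : bidual (ell1 R)).

Lemma coord_bounded i : bounded_functional (fun a => a i).
Proof.
by apply: (@bounded_functionalP _ _ _ 1) => // a; rewrite mul1r ell1_norm_coord.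
Qed.

Definition coord i : dual (ell1 R) := Dual _ (coord_bounded i).

Lemma series_delta_le i N :
  series (fun n => rnorm ((n == i)%:R : R[i]^o)) N <= 1.
Proof.
rewrite /series /= big_mkord; have [iN|Ni] := ltnP i N.
  rewrite (bigD1 (Ordinal iN)) //= eqxx big1 => [|j]; last first.
    by rewrite -val_eqE /= => /negbTE ->; rewrite rnorm0.
  by rewrite addr0 /rnorm normr1.
rewrite big1 ?ler01 // => j _; rewrite (ltn_eqF (leq_trans (ltn_ord j) Ni)).
exact: rnorm0.
Qed.

Lemma delta_summable i : abs_summable (fun n => (n == i)%:R : R[i]^o).
Proof. exact: abs_summableP (series_delta_le i). Qed.

Definition delta i : ell1 R := Ell1 (delta_summable i).

Lemma tail_summable a N :
  abs_summable (fun n => if (n < N)%N then 0 else a n).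
Proof.
apply: (@abs_summableP _ _ (ell1_norm a)) => M; apply: le_trans (ell1_norm_ub a M).
by apply: ler_sum => i _; case: ifP => // _; rewrite rnorm0 rnorm_ge0.
Qed.

Definition tail a N : ell1 R := Ell1 (tail_summable a N).

Lemma tail0 a : tail a 0 = a.
Proof. exact: ell1P. Qed.

Lemma tailS a N : tail a N = a N *: delta N + tail a N.+1.
Proof.
apply: ell1P => n; change ((if (n < N)%N then 0 else a n) =
  a N * (n == N)%:R + (if (n < N.+1)%N then 0 else a n)).
rewrite [(n < N.+1)%N]ltnS (leq_eqVlt n).
have [->|_] /= := eqVneq n N; first by rewrite ltnn mulr1 addr0.
by rewrite mulr0 add0r.
Qed.

Lemma rnorm_tail a N :
  rnorm (tail a N) <= rnorm a - series (fun n => rnorm (a n)) N.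
Proof.
rewrite !ell1_rnormE; apply: ell1_norm_le => M.
set T := fun n => rnorm (tail a N n).
(* Summing up to [N + M] makes the first [N] terms vanish; the others are those of [a]. *)
apply: (@le_trans _ _ (series T (N + M)%N)).
  apply: (nondecreasing_series (P := xpredT)) => [n _ _|]; first exact: rnorm_ge0.
  by rewrite leq_addl.
apply: (@le_trans _ _ (series (fun n => rnorm (a n)) (N + M)%N -
  series (fun n => rnorm (a n)) N)); last by rewrite lerB// ell1_norm_ub.
elim: M => [|M IH]; last first.
  by rewrite addnS !seriesSr addrAC lerD// /T /= ltnNge leq_addr.
rewrite addn0 subrr /series /= big_nat big1 // => i /andP[_ iN].
by rewrite /T /= iN rnorm0.
Qed.

Lemma tail_small a (e : R) : 0 < e -> exists N, rnorm (tail a N) <= e.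
Proof.
move=> e0; have as_ : cvgn (series (fun n => rnorm (a n))).
  exact: (asboolW (valP a)).
have /cvgrPdist_le/(_ _ e0)[N _ /(_ N (leqnn N)) /= aN] := as_.
exists N; apply: le_trans (rnorm_tail a N) _.
by apply: le_trans aN; exact: ler_norm.
Qed.

(** * The dual of ell^1 as bounded sequences, and its subspace c_0 *)

Lemma dual_tail f a N :
  f a = \sum_(0 <= i < N) a i * f (delta i) + f (tail a N).
Proof.
elim: N => [|N IH]; first by rewrite big_geq// add0r tail0.
by rewrite IH big_nat_recr//= tailS linearD linearZ/= addrA.
Qed.

Lemma rnorm_sum (u : nat -> R[i]^o) N :
  rnorm (\sum_(0 <= i < N) u i : R[i]^o) <= \sum_(0 <= i < N) rnorm (u i).
Proof.
elim: N => [|N IH]; first by rewrite !big_geq// rnorm0.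
by rewrite !big_nat_recr//= (le_trans (rnormD _ _))// lerD.
Qed.

Lemma weighted_sum_le (c : nat -> R[i]) (C : R) a N : 0 <= C ->
  (forall i, (i < N)%N -> rnorm (c i : R[i]^o) <= C) ->
  rnorm (\sum_(0 <= i < N) a i * c i : R[i]^o) <= C * rnorm a.
Proof.
move=> C0 cC; apply: le_trans (rnorm_sum _ _) _.
apply: le_trans (ler_wpM2l C0 (ell1_norm_ub a N)).
rewrite /series /= mulr_sumr !big_nat; apply: ler_sum => i /andP[_ iN].
by rewrite rnormM mulrC ler_wpM2r ?rnorm_ge0 ?cC.
Qed.

(** A finite head of [a] contributes at most [C * rnorm a], and by continuity of [f] the tail
    contributes at most an arbitrary [e]. Adding 1 to the norm keeps the divisor positive when [f]
    is 0. *)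
Lemma dual_norm_le_delta f (C : R) : 0 <= C ->
  (forall i, rnorm (f (delta i)) <= C) -> dual_norm f <= C.
Proof.
move=> C0 fC; apply: dual_norm_le => // a; apply/ler_addgt0Pr => e e0.
have f0 : 0 < dual_norm f + 1 by rewrite ltr_wpDl ?dual_norm_ge0.
have [|N aN] := tail_small a (e := e / (dual_norm f + 1)).
  by rewrite divr_gt0.
rewrite (dual_tail f a N) (le_trans (rnormD _ _))// lerD//.
  exact: weighted_sum_le.
apply: le_trans (dual_norm_ub _ _) _.
apply: le_trans (ler_wpM2l (dual_norm_ge0 f) aN) _.
by rewrite mulrA ler_pdivrMr// mulrC ler_wpM2l ?(ltW e0)// lerDl.
Qed.

Lemma ell1_cvg0 a : a i @[i --> \oo] --> (0 : R[i]^o).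
Proof.
have as_ : cvgn (series (fun n => rnorm (a n))) by exact: (asboolW (valP a)).
apply/rcvgP => e e0; have /cvgrPdist_le/(_ _ e0) := cvg_series_cvg_0 as_.
by apply: filterS => i; rewrite sub0r normrN ger0_norm ?rnorm_ge0// sub0r rnormN.
Qed.

(** This puts [dual_act f a] and [bidual_act p f] in c_0: their values at [delta i] are an ell^1
    sequence times a bounded one. *)
Lemma bounded_mul_ell1_cvg0 (c : nat -> R[i]) (C : R) a :
  (forall i, rnorm (c i : R[i]^o) <= C) ->
  (a i * c i : R[i]^o) @[i --> \oo] --> (0 : R[i]^o).
Proof.
move=> cC; have C1 : 0 < C + 1.
  by rewrite ltr_wpDl// (le_trans (rnorm_ge0 _) (cC 0%N)).
apply/rcvgP => e e0; have /rcvgP/(_ (e / (C + 1))) := ell1_cvg0 a.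
rewrite divr_gt0// => /(_ isT); apply: filterS => i.
rewrite !sub0r !rnormN rnormM ler_pdivlMr// => /(le_trans _); apply.
by rewrite ler_wpM2l ?rnorm_ge0// (le_trans (cC i))// lerDl.
Qed.

Lemma sum_coordE (c : nat -> R[i]) N a :
  (\sum_(0 <= i < N) c i *: coord i : dual (ell1 R)) a =
  \sum_(0 <= i < N) a i * c i.
Proof.
elim: N => [|N IH]; first by rewrite !big_geq.
by rewrite !big_nat_recr// dualDE IH dualZE (mulrC (c N)).
Qed.

Lemma sum_coord_delta (c : nat -> R[i]) N i :
  (\sum_(0 <= j < N) c j *: coord j : dual (ell1 R)) (delta i) =
  if (i < N)%N then c i else 0.
Proof.
elim: N => [|N IH]; first by rewrite big_geq.
rewrite big_nat_recr// dualDE dualZE IH /= ltnS (leq_eqVlt i) (eq_sym N).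
by have [->|_] := eqVneq i N; rewrite ?ltnn ?mulr1 ?add0r ?mulr0 ?addr0.
Qed.

(** * The projection of the bidual onto ell^1 and the Arens product *)

Lemma bidual_vanish m f : (forall i, m (coord i) = 0) ->
  f (delta i) @[i --> \oo] --> (0 : R[i]^o) -> m f = 0.
Proof.
move=> m0 f0; apply: rnorm0_eq0; apply/eqP; rewrite eq_le rnorm_ge0 andbT.
apply/ler_addgt0Pr => e e0; rewrite add0r.
have m1 : 0 < dual_norm m + 1 by rewrite ltr_wpDl ?dual_norm_ge0.
have d0 : 0 < e / (dual_norm m + 1) by rewrite divr_gt0.
have /rcvgP/(_ _ d0)[N _ fN] := f0.
(* The truncation [h] of [f] is killed by [m], and [f - h] has small values on all unit vectors,
   hence small norm. *)
pose h : dual (ell1 R) := \sum_(0 <= j < N) f (delta j) *: coord j.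
have mh : m h = 0.
  rewrite /h; elim: (N) => [|M IH]; first by rewrite big_geq// linear0.
  by rewrite big_nat_recr//= linearD linearZ/= IH m0 scaler0 addr0.
have -> : m f = m (f - h) by rewrite linearB/= mh subr0.
apply: le_trans (dual_norm_ub _ _) _.
have fh : dual_norm (f - h) <= e / (dual_norm m + 1).
  apply: dual_norm_le_delta => [|i]; first exact: ltW.
  rewrite dualDE dualNE sum_coord_delta; case: ltnP => iN.
    by rewrite subrr rnorm0 ltW.
  by rewrite subr0 -rnormN -sub0r fN.
apply: le_trans (ler_wpM2l (dual_norm_ge0 m) fh) _.
by rewrite mulrA ler_pdivrMr// mulrC ler_wpM2l ?(ltW e0)// lerDl.
Qed.

Lemma phase (z : R[i]) :
  exists2 u : R[i], rnorm (u : R[i]^o) <= 1 & u * z = `|z|.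
Proof.
exists (`|z| / z).
  have [->|z0] := eqVneq z 0; first by rewrite invr0 mulr0 rnorm0 ler01.
  by rewrite -lecR rnormE normrM normrV ?unitfE// normr_id mulfV ?normr_eq0.
have [->|z0] := eqVneq z 0; first by rewrite mulr0 normr0.
by rewrite mulfVK.
Qed.

(** Weighting the coordinates by phases turns a partial sum of moduli into one value of [m], at a
    functional of norm at most 1. *)
Lemma bidual_coord_summable m : abs_summable (fun i => m (coord i)).
Proof.
apply: (@abs_summableP _ _ (dual_norm m)) => N.
have /choice[u uP] : forall i, exists u : R[i],
    rnorm (u : R[i]^o) <= 1 /\ u * m (coord i) = `|m (coord i)|.
  by move=> i; have [u] := phase (m (coord i)); exists u.
pose h : dual (ell1 R) := \sum_(0 <= j < N) u j *: coord j.
have mh : m h = (series (fun n => rnorm (m (coord n))) N)%:C.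
  rewrite /h; elim: (N) => [|M IH].
    by rewrite /series /= !big_geq// linear0.
  rewrite seriesSr rmorphD /= rnormE -(uP M).2.
  by rewrite big_nat_recr//= linearD linearZ/= IH.
have h1 : dual_norm h <= 1.
  apply: dual_norm_le_delta => // i; rewrite sum_coord_delta.
  by case: ifP => _; [exact: (uP i).1|rewrite rnorm0].
have s0 : 0 <= series (fun n => rnorm (m (coord n))) N.
  by rewrite /series /=; apply: sumr_ge0 => i _; exact: rnorm_ge0.
rewrite -(rnormC s0) -mh; apply: le_trans (dual_norm_ub _ _) _.
by rewrite ler_piMr ?dual_norm_ge0.
Qed.

Definition bidual_coord m : ell1 R := Ell1 (bidual_coord_summable m).

Lemma bidual_coord_canon a : bidual_coord (Defs.canon a) = a.
Proof. exact: ell1P. Qed.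

Lemma bidual_c0E m f : f (delta i) @[i --> \oo] --> (0 : R[i]^o) ->
  m f = f (bidual_coord m).
Proof.
move=> f0; apply/eqP; rewrite -subr_eq0; apply/eqP.
apply: (@bidual_vanish (m - Defs.canon (bidual_coord m))) f0 => i.
exact: subrr.
Qed.

Lemma rnorm_delta i : rnorm (delta i) <= 1.
Proof. exact: ell1_norm_le (series_delta_le i). Qed.

Lemma dual_delta_le f i : rnorm (f (delta i)) <= dual_norm f.
Proof.
by rewrite (le_trans (dual_norm_ub _ _))// ler_piMr ?dual_norm_ge0 ?rnorm_delta.
Qed.

Lemma mul_delta a i : bmul a (delta i) = a i *: delta i.
Proof.
apply: ell1P => n; change (a n * (n == i)%:R = a i * (n == i)%:R).
by have [->|_] := eqVneq n i; rewrite ?mulr0.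
Qed.

Lemma ell1_bmulC a b : bmul a b = bmul b a.
Proof. by apply: ell1P => n; exact: mulrC. Qed.

Lemma dual_act_deltaE f a i : dual_act f a (delta i) = a i * f (delta i).
Proof. by rewrite /= mul_delta linearZ. Qed.

(** The product evaluates [p] at [dual_act f a] and [m] at [bidual_act p f]. Both functionals lie in
    c_0, where an element of the bidual acts through its projection. *)
Lemma bidual_mulE m p :
  bmul m p = Defs.canon (bmul (bidual_coord m) (bidual_coord p)) :> bidual (ell1 R).
Proof.
rewrite [LHS]arensE; apply: dualP => f.
have dact a : p (dual_act f a) = f (bmul a (bidual_coord p)).
  rewrite bidual_c0E//; under eq_fun do rewrite dual_act_deltaE.
  exact: bounded_mul_ell1_cvg0 (dual_delta_le f).
rewrite /= bidual_c0E /= ?dact//.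
have -> : (fun i => p (dual_act f (delta i))) =
    fun i => (bidual_coord p) i * f (delta i).
  by apply/funext => i; rewrite dact ell1_bmulC mul_delta linearZ.
exact: bounded_mul_ell1_cvg0 (dual_delta_le f).
Qed.

(** The partial sums of [c i *: coord i] need not converge in norm, but they converge pointwise and
    are uniformly bounded by [C], so their limit is a bounded functional. *)
Lemma bounded_seq_dual (c : nat -> R[i]) (C : R) :
  (forall i, rnorm (c i : R[i]^o) <= C) ->
  exists f : dual (ell1 R), forall i, f (delta i) = c i.
Proof.
move=> cC; have C0 : 0 <= C := le_trans (rnorm_ge0 _) (cC 0%N).
pose S N : dual (ell1 R) := \sum_(0 <= i < N) c i *: coord i.
have SC N a : rnorm (S N a) <= C * rnorm a.
  by rewrite sum_coordE; apply: weighted_sum_le.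
(* Both sums agree on the first [N] coordinates, so the tail of [a] controls the Cauchy
   differences. *)
have S_stable N N' a : (N <= N')%N -> S N a - S N' a = - S N' (tail a N).
  move=> NN'; rewrite (dual_tail (S N') a N) opprD addrA [X in X - _](_ : _ = 0).
    by rewrite sub0r.
  apply/eqP; rewrite subr_eq0 sum_coordE; apply/eqP.
  apply: eq_big_nat => i /andP[_ iN].
  by rewrite sum_coord_delta (leq_trans iN NN').
have /choice[l Sl] : forall a, exists l, S N a @[N --> \oo] --> (l : R[i]^o).
  move=> a; apply/cvg_ex; apply: complex_cauchy_cvg; apply/rcauchyP => e e0.
  have C1 : 0 < C + 1 by rewrite ltr_wpDl.
  have [|N aN] := tail_small a (e := e / (C + 1)); first by rewrite divr_gt0.
  exists (S N a); exists N => // N' /= NN'.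
  rewrite S_stable// rnormN (le_trans (SC _ _))// (le_trans (ler_wpM2l C0 aN))//.
  by rewrite mulrA ler_pdivrMr// mulrC ler_wpM2l ?(ltW e0)// lerDl.
have l_lin : linear l.
  move=> z a b; apply: (cvg_unique (@norm_hausdorff _ _) (Sl (z *: a + b))).
  rewrite (_ : (fun N => _) = (fun N => z *: S N a + S N b)).
    by apply: cvgD => //; apply: cvgZr.
  by apply/funext => N; rewrite linearP.
have lC a : rnorm (l a) <= C * rnorm a.
  apply/ler_addgt0Pr => e e0.
  have /rcvgP/(_ e e0)[N _ /(_ N (leqnn N)) /= Na] := Sl a.
  rewrite -[l a](subrK (S N a)) (le_trans (rnormD _ _))// addrC lerD//.
exists (Dual l (bounded_functionalP l_lin lC)) => i /=.
apply: (cvg_unique (@norm_hausdorff _ _) (Sl (delta i))).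
(* From [i.+1] on, [S N] includes the coordinate [i]. *)
apply/rcvgP => e e0; exists i.+1 => // N /= iN.
by rewrite sum_coord_delta iN subrr rnorm0 ltW.
Qed.

(** * Orthogonally additive maps and powers on ell^1 *)

Lemma bmul_delta_tail a N (z : R[i]) : bmul (z *: delta N) (tail a N.+1) = 0.
Proof.
apply: ell1P => n.
change (z * (n == N)%:R * (if (n < N.+1)%N then 0 else a n) = 0).
have [->|_] := eqVneq n N; last by rewrite mulr0 mul0r.
by rewrite ltnSn mulr0.
Qed.

(** Multiples of unit vectors split off orthogonally one by one and contribute 0, so [D a] equals
    [D] at every tail, which the growth bound makes arbitrarily small. *)
Lemma orthogonally_additive_ell1_eq0 (D : ell1 R -> R[i]^o) (k : nat) (C : R) :
  (0 < k)%N -> orthogonally_additive D ->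
  (forall i (z : R[i]), D (z *: delta i) = 0) ->
  (forall a, rnorm (D a) <= C * rnorm a ^+ k) ->
  forall a, D a = 0.
Proof.
move=> k0 Doa Ddelta DC a.
have Dtail N : D a = D (tail a N).
  elim: N => [|N ->]; first by rewrite tail0.
  have orth := bmul_delta_tail a N (a N).
  by rewrite [in LHS]tailS Doa// ?Ddelta ?add0r// ell1_bmulC.
apply: rnorm0_eq0; apply/eqP; rewrite eq_le rnorm_ge0 andbT.
apply/ler_addgt0Pr => e e0; rewrite add0r.
have C1 : 0 < `|C| + 1 by rewrite ltr_wpDl.
(* With tails of norm at most 1, the [k]-th power of the norm is at most the norm itself, as [k] is
   positive. *)
pose d := Num.min 1 (e / (`|C| + 1)).
have d0 : 0 < d by rewrite lt_min ltr01 divr_gt0.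
have [N aN] := tail_small a d0; rewrite (Dtail N) (le_trans (DC _))//.
have dk : rnorm (tail a N) ^+ k <= e / (`|C| + 1).
  have d1 : d <= 1 by rewrite ge_min lexx.
  apply: (@le_trans _ _ d); last by rewrite ge_min lexx orbT.
  apply: (le_trans _ aN); rewrite -(prednK k0) exprS ler_piMr ?rnorm_ge0//.
  by rewrite exprn_ile1 ?rnorm_ge0// (le_trans aN).
apply: (@le_trans _ _ ((`|C| + 1) * rnorm (tail a N) ^+ k)).
  by rewrite ler_wpM2r ?exprn_ge0 ?rnorm_ge0// (le_trans (ler_norm C))// lerDl.
by rewrite mulrC -ler_pdivlMr.
Qed.

Lemma bpowE a j i : (bpow a j.+1 : ell1 R) i = a i ^+ j.+1.
Proof.
elim: j => [|j IH]; first by rewrite expr1.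
by rewrite exprS -IH bpow_succ.
Qed.

(** A vanishing pointwise product means disjoint supports, so at each index only one summand
    survives. *)
Lemma bpowD a b j : bmul a b = 0 ->
  bpow (a + b) j.+1 = bpow a j.+1 + bpow b j.+1.
Proof.
move=> ab0; apply: ell1P => i.
change ((bpow (a + b) j.+1 : ell1 R) i =
  (bpow a j.+1 : ell1 R) i + (bpow b j.+1 : ell1 R) i); rewrite !bpowE.
change ((a i + b i) ^+ j.+1 = (a i : R[i]) ^+ j.+1 + (b i : R[i]) ^+ j.+1).
have /eqP : (a i : R[i]) * b i = 0.
  by change ((bmul a b : ell1 R) i = 0); rewrite ab0.
by rewrite mulf_eq0 => /orP[/eqP ->|/eqP ->]; rewrite expr0n ?addr0 ?add0r.
Qed.

Lemma bpow_delta (z : R[i]) i j : bpow (z *: delta i) j.+1 = z ^+ j.+1 *: delta i.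
Proof.
apply: ell1P => n; rewrite bpowE.
change ((z * (n == i)%:R) ^+ j.+1 = z ^+ j.+1 * (n == i)%:R).
by rewrite exprMn; case: eqP; rewrite ?expr1n ?expr0n.
Qed.

(** The exponent starts at 2 because [m] itself need not lie in ell^1, while a product of two
    factors does. *)
Lemma bpow_bidualE m j :
  bpow m j.+2 = Defs.canon (bpow (bidual_coord m) j.+2) :> bidual (ell1 R).
Proof.
elim: j => [|j IH]; first exact: bidual_mulE.
by rewrite bpow_succ IH bidual_mulE bidual_coord_canon.
Qed.

Lemma canonD a b : Defs.canon (a + b) = Defs.canon a + Defs.canon b.
Proof. by apply: dualP => f; exact: linearD. Qed.

Lemma canonZ (z : R[i]) a : Defs.canon (z *: a) = z *: Defs.canon a.
Proof. by apply: dualP => f; exact: linearZ. Qed.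

Lemma rnorm_canon a : rnorm (Defs.canon a) <= rnorm a.
Proof.
rewrite dual_rnormE; apply: dual_norm_le => [|f]; first exact: rnorm_ge0.
by rewrite mulrC; exact: (dual_norm_ub f a).
Qed.

Lemma bidual_mul_coord0r m p : bidual_coord p = 0 -> bmul m p = 0.
Proof.
move=> p0; rewrite bidual_mulE p0.
have -> : bmul (bidual_coord m) 0 = 0 by apply: ell1P => i; exact: mulr0.
by apply: dualP => f; exact: linear0.
Qed.

Lemma bidual_mul_coord0l m p : bidual_coord m = 0 -> bmul m p = 0.
Proof.
by move=> m0; rewrite bidual_mulE ell1_bmulC -bidual_mulE bidual_mul_coord0r.
Qed.

Lemma bidual_coord_sub_canon m :
  bidual_coord (m - Defs.canon (bidual_coord m)) = 0.
Proof. by apply: ell1P => i; exact: subrr. Qed.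

End ell1_coordinates.

Theorem corollary3p4 (R : realType) (k : nat) (hk : (2 <= k)%N) :
  OA_property (bidual (ell1 R)) k.
Proof.
case: k hk => [|[|k]]// _ P Pk Poa.
have [C C0 PC] := homogeneous_polynomial_bounded Pk.
pose Q (a : ell1 R) := P (Defs.canon a).
have QC a : rnorm (Q a) <= C * rnorm a ^+ k.+2.
  rewrite (le_trans (PC _))// ler_wpM2l// lerXn2r ?nnegrE ?rnorm_ge0//.
  exact: rnorm_canon.
(* On ell^1 the values at unit vectors determine the candidate [g]; they are bounded by [C]. *)
have [g gE] : exists g : dual (ell1 R), forall i, g (delta i) = Q (delta i).
  apply: (@bounded_seq_dual _ (fun i => Q (delta i)) C) => i.
  rewrite (le_trans (QC _))// ler_piMr// exprn_ile1 ?rnorm_ge0//.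
  exact: rnorm_delta.
have QE a : Q a = g (bpow a k.+2).
  apply/eqP; rewrite -subr_eq0; apply/eqP; move: a.
  (* The difference is orthogonally additive and, by homogeneity, vanishes on all multiples of unit
     vectors. *)
  apply: (@orthogonally_additive_ell1_eq0 _ (fun a => Q a - g (bpow a k.+2))
    k.+2 (C + dual_norm g)) => //.
  - move=> a b ab0 ba0; rewrite bpowD// linearD /Q canonD Poa; first 1 last.
    + by rewrite bidual_mulE !bidual_coord_canon ab0;
        apply: dualP => f; exact: linear0.
    + by rewrite bidual_mulE !bidual_coord_canon ba0;
        apply: dualP => f; exact: linear0.
    by rewrite opprD addrACA.
  - move=> i z; rewrite bpow_delta linearZ /= gE /Q canonZ.
    by rewrite (homogeneous_polynomialZ Pk) subrr.
  - move=> a; rewrite (le_trans (rnormD _ _))// rnormN mulrDl lerD//.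
    rewrite (le_trans (dual_norm_ub _ _))// ler_wpM2l ?dual_norm_ge0//.
    exact: rnorm_bpow.
(* The representing functional on the bidual is evaluation at [g]. It remains to show that [P] only
   sees the projection of [m]. *)
exists (Defs.canon g) => m; rewrite bpow_bidualE /= -QE /Q.
set p := m - Defs.canon (bidual_coord m).
have p0 : bidual_coord p = 0 := bidual_coord_sub_canon m.
have Pp : P p = 0.
  (* [p] is orthogonal to itself, so [2 ^+ k.+2 * P p = 2 * P p], and the two factors differ since
     the degree exceeds 1. *)
  have : P (p + p) = P p + P p by apply: Poa; exact: bidual_mul_coord0l.
  rewrite -mulr2n -scaler_nat (homogeneous_polynomialZ Pk) -mulr2n.
  move: (P p) => z; change ((2 ^+ k.+2 : R[i]) * z = z *+ 2 -> z = 0).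
  rewrite -[z *+ 2]mulr_natl => /eqP; rewrite -subr_eq0 -mulrBl mulf_eq0 => /orP[|/eqP//].
  by rewrite subr_eq0 -natrX eqr_nat -[X in _ == X]expn1 eqn_exp2l.
rewrite -{1}[m](subrK (Defs.canon (bidual_coord m))) -/p.
rewrite Poa ?Pp ?add0r//; [exact: bidual_mul_coord0l|exact: bidual_mul_coord0r].
Qed.
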